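(* If $G$ is a cubic graph (a finite simple graph in which every vertex has degree $3$), then $C_3(G)=4$ if $G$ is bipartite, and $C_3(G)=3$ otherwise.
   Context: A set $S\subseteq V(G)$ is a $3$-dominating set of $G$ if every vertex $v\in V(G)\setminus S$ has at least $3$ neighbors in $S$. Two disjoint sets $A,B\subseteq V(G)$ form a $3$-coalition if neither $A$ nor $B$ is a $3$-dominating set of $G$ but $A\cup B$ is a $3$-dominating set of $G$. A $3$-coalition partition of $G$ is a partition $\Theta$ of $V(G)$ such that every set in $\Theta$ is either a $3$-dominating set of cardinality $3$ or forms a $3$-coalition with another set of $\Theta$. $C_3(G)$ is the maximum cardinality of a $3$-coalition partition of $G$. *)

(* Defs.v *)
From mathcomp Require Import all_boot.

Set Implicit Arguments.
Unset Strict Implicit.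
Unset Printing Implicit Defensive.

Record sgraph := SGraph {
  vertex :> finType;
  adj : rel vertex;
  adj_sym : symmetric adj;
  adj_irrefl : irreflexive adj
}.

Section ThreeCoalitions.

Variable G : sgraph.

Definition neighbors (v : G) : {set G} := [set u | adj v u].

Definition cubic : Prop := forall v : G, #|neighbors v| = 3.

Definition bipartite : Prop :=
  exists X : {set G}, forall u v : G, adj u v -> (u \in X) != (v \in X).

Definition dominating3 (S : {set G}) : bool :=
  [forall v, (v \notin S) ==> (3 <= #|neighbors v :&: S|)].

Definition coalition3 (A B : {set G}) : bool :=
  [&& [disjoint A & B], ~~ dominating3 A, ~~ dominating3 B
    & dominating3 (A :|: B)].

(* The blocks of a partition are nonempty, as enforced by [partition]. *)
Definition coalition3_partition (Theta : {set {set G}}) : bool :=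
  partition Theta [set: G] &&
  [forall A in Theta,
     (dominating3 A && (#|A| == 3)) ||
     [exists B in Theta, (B != A) && coalition3 A B]].

(* The maximum is 0 when G has no 3-coalition partition. *)
Definition C3 : nat := \max_(Theta | coalition3_partition Theta) #|Theta|.

End ThreeCoalitions.

(* Main.v *)
(** In a cubic graph a set is 3-dominating iff its complement is independent, so
    two blocks of a partition form a coalition iff the union of all other blocks
    is independent, while neither block has an independent complement.

    Suppose there are at least four blocks.  Two disjoint coalition pairs
    [A, B] and [C, D] make both [A :|: B] and its complement independent, so the
    graph is bipartite and there is no fifth block.  Otherwise the coalitions form
    a star with centre [A]; for an edge outside [A] some block other than [A] avoids
    both ends, contradicting its coalition with [A], so [A] itself would be
    3-dominating.  A dominating block [S] with three vertices is joined completely to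
    its complement, which thus has at most three vertices, with equality only for
    K_{3,3}.

    Conversely, [{u}], [{v}] and the rest for an edge [uv] are three suitable blocks,
    and splitting both sides of a bipartition in two gives four. *)

Require Import Defs.
From mathcomp Require Import all_boot.

Set Implicit Arguments.
Unset Strict Implicit.
Unset Printing Implicit Defensive.

Lemma exists_notin_seq (T : finType) (A : {set T}) (s : seq T) :
  size s < #|A| -> exists2 x, x \in A & x \notin s.
Proof.
move=> ltsA; apply/exists_inP; apply: contraLR ltsA => /exists_inPn sub.
rewrite -leqNgt (leq_trans _ (card_size s)) //; apply/subset_leq_card/subsetP.
by move=> x /sub; rewrite negbK.
Qed.

Section CubicGraph.

Variable G : sgraph.
Hypothesis G_cubic : cubic G.

Implicit Types (u v w x y : G) (A B C D S : {set G}) (Theta : {set {set G}}).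

(** * Domination in cubic graphs *)

Lemma exists_neighbor_neq v w : exists2 u, adj v u & u != w.
Proof.
have [|u] := @exists_notin_seq _ (neighbors v) [:: w]; first by rewrite G_cubic.
by rewrite !inE => vu uw; exists u.
Qed.

(** As degrees are 3, having at least three neighbours in [S] means having all of them there. *)
Lemma dominating3P S :
  reflect (forall u v, adj u v -> u \notin S -> v \in S) (dominating3 S).
Proof.
apply: (iffP forallP) => [domS u v uv uS | domS v].
  have := implyP (domS u) uS; rewrite -(G_cubic u) => le.
  have /eqP/setIidPl/subsetP -> // : neighbors u :&: S == neighbors u.
    by rewrite eqEcard subsetIl.
  by rewrite inE.
apply/implyP => vS; suff /setIidPl-> : neighbors v \subset S by rewrite G_cubic.
by apply/subsetP => u; rewrite inE => vu; apply: domS vu vS.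
Qed.

Lemma dominating3Pn S :
  reflect (exists u v, [/\ adj u v, u \notin S & v \notin S]) (~~ dominating3 S).
Proof.
apply: (iffP idP) => [|[u [v [uv uS vS]]]]; last first.
  by apply/dominating3P => /(_ u v uv uS); rewrite (negPf vS).
have [|noedge] := boolP [exists u, exists v, [&& adj u v, u \notin S & v \notin S]].
  by move=> /existsP[u /existsP[v /and3P[uv uS vS]]] _; exists u, v.
case/dominating3P => u v uv uS; apply: contraNT noedge => vS.
by apply/existsP; exists u; apply/existsP; exists v; apply/and3P.
Qed.

(** * Lower bounds from vertex labellings *)

Section FibrePartition.

Variables (I : finType) (f : G -> I).
Hypothesis f_surj : forall i, exists v, f v = i.

Let fibre i : {set G} := [set v | f v == i].

Hypothesis fibre_not_dominating :
  forall i, exists u v, [/\ adj u v, f u != i & f v != i].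
Hypothesis fibre_partner : forall i, exists2 j, j != i &
  forall u v, adj u v -> f u \notin [:: i; j] -> f v \in [:: i; j].

Let fibre_inj : injective fibre.
Proof.
move=> i j /setP eq_ij; have [v fv] := f_surj i.
by apply/eqP; have := eq_ij v; rewrite !inE fv eqxx => <-.
Qed.

(** Encoding a partition by labels turns the coalition conditions into finite checks on the two ends
    of an edge. Surjectivity keeps the fibres nonempty and distinct. *)
Lemma C3_ge_fibres : #|I| <= C3 G.
Proof.
pose Theta := [set fibre i | i in I].
have <- : #|Theta| = #|I| by rewrite card_imset.
apply: leq_bigmax_cond; apply/andP; split; last first.
  apply/forall_inP => _ /imsetP[i _ ->]; apply/orP; right.
  have ndom k : ~~ dominating3 (fibre k).
    have [u [v [uv fu fv]]] := fibre_not_dominating k.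
    by apply/dominating3Pn; exists u, v; rewrite !inE.
  have [j ji dom] := fibre_partner i.
  apply/exists_inP; exists (fibre j); first exact: imset_f.
  rewrite (inj_eq fibre_inj) ji; apply/and4P; split; rewrite ?ndom //.
    rewrite -setI_eq0; apply/eqP/setP => v; rewrite !inE.
    by apply/negP => /andP[/eqP fi /eqP fj]; rewrite -fi -fj eqxx in ji.
  by apply/dominating3P => u v /dom; rewrite !inE.
apply/and3P; split.
- apply/eqP/setP => v; rewrite inE; apply/bigcupP; exists (fibre (f v)).
    exact: imset_f.
  by rewrite inE.
- apply/trivIsetP => _ _ /imsetP[i _ ->] /imsetP[j _ ->] neq.
  rewrite -setI_eq0; apply/eqP/setP => v; rewrite !inE.
  by apply/negP => /andP[/eqP fi /eqP fj]; rewrite -fi -fj eqxx in neq.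
apply/imsetP => -[i _ /setP]; have [v fv] := f_surj i.
by move/(_ v); rewrite !inE fv eqxx.
Qed.

End FibrePartition.

Lemma C3_ge3 : 0 < #|G| -> 3 <= C3 G.
Proof.
move=> /card_gt0P[u _]; have [v uv vu] := exists_neighbor_neq u u.
(* The edge [vz] will show that {u} is not dominating, [uw] that {v} is not, and [uv] that the rest
   is not. *)
have [w uw wv] := exists_neighbor_neq u v.
have [z vz zu] := exists_neighbor_neq v u.
have wu : w != u by apply: contraTneq uw => ->; rewrite adj_irrefl.
have zv : z != v by apply: contraTneq vz => ->; rewrite adj_irrefl.
pose f x := if x == u then Some true else if x == v then Some false else None.
have fu : f u = Some true by rewrite /f eqxx.
have fv : f v = Some false by rewrite /f (negPf vu) eqxx.
have fw : f w = None by rewrite /f (negPf wu) (negPf wv).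
have fz : f z = None by rewrite /f (negPf zu) (negPf zv).
have fP x b : f x = Some b -> x = if b then u else v.
  by rewrite /f; case: eqP => [-> [<-] //|_]; case: eqP => [-> [<-] |].
have <- : #|{: option bool}| = 3 by rewrite card_option card_bool.
apply: (@C3_ge_fibres _ f) => [[[]|]|[[]|]|i].
- by exists u.
- by exists v.
- by exists w.
- by exists v, z; rewrite fv fz.
- by exists u, w; rewrite fu fw.
- by exists u, v; rewrite fu fv.
have indep x y b : adj x y -> f x = Some b -> f y <> Some b.
  by move=> xy /fP xE /fP yE; rewrite xE yE adj_irrefl in xy.
(* A singleton joined with the rest leaves only the other singleton outside, which spans no edge. *)
exists (if i is Some _ then None else Some true); first by case: i.
move=> x y xy; have := indep x y; rewrite !inE.
by case: i => [[]|]; case: (f x) => [[]|] //; case: (f y) => [[]|] //;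
   move=> /(_ _ xy erefl).
Qed.

Lemma C3_ge4 : 0 < #|G| -> bipartite G -> 4 <= C3 G.
Proof.
move=> /card_gt0P[x _] [X bipX]; have [y xy _] := exists_neighbor_neq x x.
have flip u v : adj u v -> (v \in X) = ~~ (u \in X).
  by move=> /bipX; case: (u \in X); case: (v \in X).
pose g b := if (x \in X) == b then x else y.
have gX b : (g b \in X) = b.
  by rewrite /g; case: eqP => // /eqP; rewrite (flip x y xy); case: b (x \in X) => [] [].
(* Each side [b] is split into the single vertex [g b] and its remaining vertices. *)
pose f u := (u \in X, u == g (u \in X)).
have f_surj i : exists v, f v = i.
  case: i => b []; first by exists (g b); rewrite /f gX eqxx.
  (* Neighbours of [g (~~ b)] lie on side [b]; one other than [g b] has label [(b, false)]. *)
  have [v gv vg] := exists_neighbor_neq (g (~~ b)) (g b).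
  by exists v; rewrite /f (flip _ _ gv) gX negbK (negPf vg).
have <- : #|{: bool * bool}| = 4 by rewrite card_prod card_bool.
apply: (@C3_ge_fibres _ f) => // -[a b].
  have [u fu] := f_surj (a, ~~ b); have [v uv _] := exists_neighbor_neq u u.
  exists u, v; split=> //; first by rewrite fu xpair_eqE eqxx; case: (b).
  have uX : (u \in X) = a by case: fu.
  by rewrite /f xpair_eqE (flip u v uv) uX; case: (a).
(* The partner is the other half of the same side, so the union is a whole side. *)
exists (a, ~~ b); first by rewrite xpair_eqE eqxx; case: (b).
move=> u v uv; rewrite !inE /f !xpair_eqE (flip u v uv).
by case: a; case: b; case: (u \in X); case: (u == _); case: (v == _).
Qed.

(** * Upper bounds on the number of blocks *)

Section UpperBound.

Variable Theta : {set {set G}}.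
Hypothesis Theta_part : partition Theta [set: G].

Let block_of x : exists2 A, A \in Theta & x \in A.
Proof.
have /and3P[/eqP coverT _ _] := Theta_part.
by apply/bigcupP; rewrite -/(cover Theta) coverT inE.
Qed.

Let block_uniq A B x : A \in Theta -> B \in Theta -> x \in A -> x \in B -> A = B.
Proof.
have /and3P[_ triv _] := Theta_part => At Bt xA xB.
by rewrite -(def_pblock triv At xA) (def_pblock triv Bt xB).
Qed.

Let block_nonempty A : A \in Theta -> exists x, x \in A.
Proof.
have /and3P[_ _ n0] := Theta_part => At; apply/set0Pn.
by apply: contraNneq n0 => <-.
Qed.

Lemma disjoint_pairs_bound A B C D :
    A \in Theta -> B \in Theta -> C \in Theta -> D \in Theta ->
    A \notin [:: C; D] -> B \notin [:: C; D] ->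
    dominating3 (A :|: B) -> dominating3 (C :|: D) ->
  #|Theta| <= 4 /\ bipartite G.
Proof.
rewrite !inE !negb_or => At Bt Ct Dt /andP[AC AD] /andP[BC BD].
move=> /dominating3P domAB /dominating3P domCD.
have disj x : x \in A :|: B -> x \notin C :|: D.
  rewrite !inE; apply: contraTN => /orP[xC|xD]; rewrite negb_or; apply/andP; split.
  - by apply: contraNN AC => xA; rewrite (block_uniq At Ct xA xC).
  - by apply: contraNN BC => xB; rewrite (block_uniq Bt Ct xB xC).
  - by apply: contraNN AD => xA; rewrite (block_uniq At Dt xA xD).
  - by apply: contraNN BD => xB; rewrite (block_uniq Bt Dt xB xD).
have cover_all x : x \notin A :|: B -> x \in C :|: D.
  (* A vertex outside both unions would have its neighbours in both, against [disj]. *)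
  move=> xAB; apply/negPn/negP => xCD; have [y xy _] := exists_neighbor_neq x x.
  by have := disj y (domAB x y xy xAB); rewrite (domCD x y xy xCD).
split.
  rewrite (leq_trans _ (card_size [:: A; B; C; D])) //.
  apply/subset_leq_card/subsetP => E Et; have [x xE] := block_nonempty Et.
  have := cover_all x; rewrite !inE.
  have [xA|_] := boolP (x \in A); first by rewrite (block_uniq Et At xE xA) eqxx.
  have [xB|_] := boolP (x \in B); first by rewrite (block_uniq Et Bt xE xB) eqxx /= !orbT.
  move=> /(_ isT)/orP[xC|xD]; first by rewrite (block_uniq Et Ct xE xC) eqxx /= !orbT.
  by rewrite (block_uniq Et Dt xE xD) eqxx !orbT.
exists (A :|: B) => u v uv; have [uAB|uAB] := boolP (u \in A :|: B).
  by apply/negP => /eqP/esym/disj; rewrite (domCD u v uv (disj u uAB)).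
by rewrite (domAB u v uv uAB).
Qed.

Lemma star_dominating A :
    3 < #|Theta| ->
    (forall B, B \in Theta -> B != A -> dominating3 (A :|: B)) ->
  dominating3 A.
Proof.
move=> Theta4 star; apply/dominating3P => u v uv uA; apply: contraTT isT => vA.
have [P Pt uP] := block_of u; have [Q Qt vQ] := block_of v.
(* With four blocks some [R] is left over, and [A :|: R] misses both [u] and [v]. *)
have [R Rt] := exists_notin_seq (s := [:: A; P; Q]) Theta4.
rewrite !inE !negb_or => /and3P[RA RP RQ].
have notR x S : S \in Theta -> R != S -> x \in S -> x \notin A -> x \notin A :|: R.
  move=> St RS xS xA; rewrite inE negb_or xA.
  by apply: contraNN RS => xR; rewrite (block_uniq Rt St xR xS).
have /dominating3P/(_ u v uv (notR u P Pt RP uP uA)) := star R Rt RA.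
by rewrite (negPf (notR v Q Qt RQ vQ vA)).
Qed.

Lemma dominating_triple_bound S :
    S \in Theta -> dominating3 S -> #|S| = 3 ->
  #|Theta| <= 4 /\ (3 < #|Theta| -> bipartite G).
Proof.
move=> St /dominating3P domS S3.
have nbr v : v \notin S -> neighbors v = S.
  move=> vS; apply/eqP; rewrite eqEcard G_cubic S3 leqnn andbT.
  by apply/subsetP => u; rewrite inE => vu; apply: domS vu vS.
have sub s : s \in S -> ~: S \subset neighbors s.
  move=> sS; apply/subsetP => v; rewrite inE => vS.
  by move: sS; rewrite -(nbr v vS) !inE adj_sym.
have leC : #|~: S| <= 3.
  have /card_gt0P[s sS] : 0 < #|S| by rewrite S3.
  by rewrite -(G_cubic s) subset_leq_card ?sub.
have leT : #|Theta| <= #|~: S|.+1.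
  (* The blocks other than [S] are nonempty and together fill [~: S], so its size bounds their
     number. *)
  rewrite (cardsD1 S) St ltnS -(leq_add2l #|S|) cardsC -cardsT.
  rewrite (card_partition Theta_part) (bigD1 S) //= leq_add2l -sum1_card.
  rewrite [leqLHS](eq_bigl (fun B => (B \in Theta) && (B != S))); last first.
    by move=> B; rewrite !inE andbC.
  apply: leq_sum => B /andP[Bt _]; apply/card_gt0P; exact: block_nonempty.
split=> [|T4]; first exact: leq_trans leT _.
(* Four blocks force equality, so each vertex of [S] has neighbourhood exactly [~: S]. *)
have cardC3 : #|~: S| = 3 by apply/eqP; rewrite eqn_leq leC -ltnS (leq_trans T4).
exists S => u v uv; have [uS|uS] := boolP (u \in S); last by rewrite (domS u v).
have eqN : ~: S = neighbors u by apply/eqP; rewrite eqEcard sub //= cardC3 G_cubic.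
by have /setP/(_ v) := eqN; rewrite !inE uv => /negPf->.
Qed.

Lemma coalition_bound :
  coalition3_partition Theta -> #|Theta| <= 4 /\ (3 < #|Theta| -> bipartite G).
Proof.
case/andP=> _ /forall_inP blocks.
have [|noS] := boolP [exists S in Theta, dominating3 S && (#|S| == 3)].
  by case/exists_inP=> S St /andP[domS /eqP S3]; apply: dominating_triple_bound St _ _.
have partner A : A \in Theta -> exists B,
    [/\ B \in Theta, B != A, ~~ dominating3 A & dominating3 (A :|: B)].
  move=> At; case/orP: (blocks A At) => [tripA|].
    by case/negP: noS; apply/exists_inP; exists A.
  by case/exists_inP=> B Bt /andP[BA /and4P[_ ndA _ dAB]]; exists B.
have [le3|T4] := leqP #|Theta| 3; first by split=> //; apply: leqW.
suff: #|Theta| <= 4 /\ bipartite G by case.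
(* If the partner of [C] is neither [A] nor [B], there are two disjoint pairs. *)
have third A B C : A \in Theta -> B \in Theta -> C \in Theta ->
    C \notin [:: A; B] -> dominating3 (A :|: B) ->
  [\/ #|Theta| <= 4 /\ bipartite G, dominating3 (A :|: C) | dominating3 (B :|: C)].
  move=> At Bt Ct CAB dAB; have [D [Dt _ _ dCD]] := partner C Ct.
  have [DA|DA] := eqVneq D A; first by rewrite DA setUC in dCD; constructor 2.
  have [DB|DB] := eqVneq D B; first by rewrite DB setUC in dCD; constructor 3.
  constructor 1; apply: (disjoint_pairs_bound Ct Dt At Bt) => //.
  by rewrite !inE (negPf DA) (negPf DB).
(* Two pairs share [A]. A block [D] not dominating together with [A] must pair with [B] by [third],
   and then [A], [C] and [B], [D] are disjoint pairs; without such a [D] there is a star at [A]. *)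
have center A B C : A \in Theta -> B \in Theta -> C \in Theta ->
    B != A -> C \notin [:: A; B] -> dominating3 (A :|: B) -> dominating3 (A :|: C) ->
  #|Theta| <= 4 /\ bipartite G.
  move=> At Bt Ct BA CAB dAB dAC; have [_ [_ _ ndA _]] := partner A At.
  have [star|] := boolP [forall D in Theta, (D != A) ==> dominating3 (A :|: D)].
    case/negP: ndA; apply: star_dominating => // D Dt DA.
    exact: implyP (forall_inP star D Dt) DA.
  case/forall_inPn=> D Dt; rewrite negb_imply => /andP[DA ndAD].
  have neq E : dominating3 (A :|: E) -> D != E by apply: contraTneq => <-.
  have DAB : D \notin [:: A; B] by rewrite !inE negb_or DA neq.
  have [//||dBD] := third A B D At Bt Dt DAB dAB; first by rewrite (negPf ndAD).
  move: CAB; rewrite !inE negb_or => /andP[CA CB].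
  apply: (disjoint_pairs_bound At Ct Bt Dt) => //.
    by rewrite !inE negb_or ![A == _]eq_sym BA.
  by rewrite !inE negb_or CB eq_sym neq.
have [|A At _] := @exists_notin_seq _ Theta [::]; first exact: leq_trans T4.
have [B [Bt BA _ dAB]] := partner A At.
have [|C Ct CAB] := @exists_notin_seq _ Theta [:: A; B]; first exact: leq_trans T4.
have [//|dAC|dBC] := third A B C At Bt Ct CAB dAB; first exact: (center A B C).
apply: (center B A C) => //; first by rewrite eq_sym.
  by move: CAB; rewrite !inE orbC.
by rewrite setUC.
Qed.

End UpperBound.

End CubicGraph.

(** The empty graph is vacuously cubic and bipartite, but has [C3] equal to 0. *)
Theorem theorem4p2 (G : sgraph) (G_nonempty : 0 < #|G|) (G_cubic : cubic G) :
  (bipartite G -> C3 G = 4) /\ (~ bipartite G -> C3 G = 3).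
Proof.
have bound (Theta : {set {set G}}) : coalition3_partition Theta ->
    #|Theta| <= 4 /\ (3 < #|Theta| -> bipartite G).
  by move=> cT; apply: coalition_bound => //; case/andP: cT.
split=> bip; apply/eqP; rewrite eqn_leq.
  by rewrite C3_ge4 // andbT; apply/bigmax_leqP => Theta /bound[].
rewrite C3_ge3 // andbT; apply/bigmax_leqP => Theta /bound[_ bipT].
by have [//|/bipT] := leqP #|Theta| 3.
Qed.
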